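(* Let $G$ be a finite group and let $H_1,\dots,H_k$ be representatives of the conjugacy classes of subgroups of $G$ (one from each class). Let $E$ be a finite dimensional Archimedean Riesz space and let $\rho\colon G\to\mathrm{Aut}^+(E)$ be a positive representation. Then there exist unique $n_1,\dots,n_k\in\mathbb{Z}_{\geq0}$ such that $\rho$ is order equivalent to \[ n_1\pi^{H_1}\oplus\cdots\oplus n_k\pi^{H_k}. \]
   Context: All Riesz spaces (vector lattices) are real. $\mathrm{Aut}^+(E)$ denotes the group of lattice automorphisms of a Riesz space $E$. A positive representation of $G$ in $E$ is a group homomorphism $\rho\colon G\to\mathrm{Aut}^+(E)$, $s\mapsto\rho_s$. For a subgroup $H\subset G$, $C(G/H)$ is the Riesz space of all real-valued functions on $G/H$ with pointwise ordering, with basis $(e_{tH})_{tH\in G/H}$ given by $e_{tH}(sH)=\delta_{tH,sH}$, and $\pi^H\colon G\to\mathrm{Aut}^+(C(G/H))$ is the positive representation determined by $\pi^H_se_{tH}=e_{stH}$ for $s,t\in G$. The order direct sum of Riesz spaces is the vector space direct sum in which an element is positive if and only if all its components are positive; the order direct sum of positive representations acts componentwise. For $n\in\mathbb{Z}_{\geq0}$, $n\rho$ denotes the $n$-fold order direct sum of $\rho$. Two positive representations $\rho$ in $E$ and $\theta$ in $F$ of $G$ are order equivalent if there is a lattice isomorphism $T\colon E\to F$ with $T\rho_s=\theta_sT$ for all $s\in G$. *)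

(* Defs.v *)
From HB Require Import structures.
From mathcomp Require Import all_boot all_order all_algebra all_fingroup.
From mathcomp Require Import boolp reals.

Set Implicit Arguments.
Unset Strict Implicit.
Unset Printing Implicit Defensive.

Import Order.TTheory GRing.Theory Num.Theory.
Local Open Scope ring_scope.

(* The lattice operations are fields of the mixin rather than inherited from
   latticeType: realDomainType already joins zmodType and latticeType, and
   Hierarchy Builder refuses a second, smaller join of the two. *)
HB.mixin Record Lmodule_POrder_isRiesz (R : realType) E
    of GRing.Lmodule R E & Num.POrderedZmodule E := {
  rmeet : E -> E -> E;
  rjoin : E -> E -> E;
  rlexI : forall x y z : E, (x <= rmeet y z) = (x <= y) && (x <= z);
  rleUx : forall x y z : E, (rjoin x y <= z) = (x <= z) && (y <= z);
  rleD2r : forall x y z : E, x <= y -> x + z <= y + z;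
  rscale_ge0 : forall (a : R) (x : E), 0 <= a -> 0 <= x -> 0 <= a *: x
}.

#[short(type="rieszType")]
HB.structure Definition Riesz (R : realType) :=
  { E of GRing.Lmodule R E & Num.POrderedZmodule E &
         Lmodule_POrder_isRiesz R E }.

#[short(type="finDimRieszType")]
HB.structure Definition FinDimRiesz (R : realType) :=
  { E of Riesz R E & Vector R E }.

Definition archimedean_riesz (R : realType) (E : rieszType R) : Prop :=
  forall x y : E, 0 <= x -> 0 <= y -> (forall n : nat, x *+ n <= y) -> x = 0.

Definition lattice_iso (R : realType) (E F : rieszType R) (T : E -> F) : Prop :=
  [/\ linear T, bijective T, {morph T : x y / rmeet x y}
    & {morph T : x y / rjoin x y}].

Record lat_aut (R : realType) (E : rieszType R) := LatAut {
  lat_aut_fun :> E -> E;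
  lat_aut_iso : lattice_iso lat_aut_fun
}.

Section LatAutGroup.
Local Open Scope group_scope.
Variables (R : realType) (E : rieszType R).
Implicit Types S T : lat_aut E.

Lemma lat_autP S T : S =1 T -> S = T.
Proof.
case: S T => [f fP] [g gP] /= /funext fg; case: _ / fg gP => gP.
by congr LatAut; apply: Prop_irrelevance.
Qed.

Lemma lat_aut_surj T (y : E) : exists x, T x == y.
Proof. by case: (lat_aut_iso T) => _ [g _ gK] _ _; exists (g y); rewrite gK. Qed.

Definition lat_inv_fun T (y : E) : E := xchoose (lat_aut_surj T y).

Lemma lat_inv_funK T : cancel (lat_inv_fun T) T.
Proof. by move=> y; apply/eqP/(xchooseP (lat_aut_surj T y)). Qed.

Lemma lat_aut_inj T : injective T.
Proof. by case: (lat_aut_iso T) => _ /bij_inj. Qed.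

Lemma lat_aut_funK T : cancel T (lat_inv_fun T).
Proof. by move=> x; apply: (@lat_aut_inj T); rewrite lat_inv_funK. Qed.

Lemma lat_one_iso : lattice_iso (@idfun E).
Proof. by split=> //; exists idfun. Qed.

Lemma lat_mul_iso S T : lattice_iso (S \o T).
Proof.
case: (lat_aut_iso S) (lat_aut_iso T) => [Sl Sb SI SU] [Tl Tb TI TU].
split; first by move=> a x y; rewrite /= Tl Sl.
- exact: bij_comp.
- by move=> x y; rewrite /= TI SI.
- by move=> x y; rewrite /= TU SU.
Qed.

Lemma lat_inv_iso T : lattice_iso (lat_inv_fun T).
Proof.
case: (lat_aut_iso T) => [Tl _ TI TU].
split; first by move=> a x y; apply: (@lat_aut_inj T); rewrite Tl !lat_inv_funK.
- by exists T; [exact: lat_inv_funK | exact: lat_aut_funK].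
- by move=> x y; apply: (@lat_aut_inj T); rewrite TI !lat_inv_funK.
- by move=> x y; apply: (@lat_aut_inj T); rewrite TU !lat_inv_funK.
Qed.

HB.instance Definition _ := gen_eqMixin (lat_aut E).
HB.instance Definition _ := gen_choiceMixin (lat_aut E).

Definition lat_one := LatAut lat_one_iso.
Definition lat_mul S T := LatAut (lat_mul_iso S T).
Definition lat_inv T := LatAut (lat_inv_iso T).

Lemma lat_mulA : associative lat_mul.
Proof. by move=> S T U; apply: lat_autP. Qed.
Lemma lat_mul1 : left_id lat_one lat_mul.
Proof. by move=> T; apply: lat_autP. Qed.
Lemma lat_mulr1 : right_id lat_one lat_mul.
Proof. by move=> T; apply: lat_autP. Qed.
Lemma lat_mulV : left_inverse lat_one lat_inv lat_mul.
Proof. by move=> T; apply: lat_autP => x; apply: lat_aut_funK. Qed.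
Lemma lat_mulrV : right_inverse lat_one lat_inv lat_mul.
Proof. by move=> T; apply: lat_autP => x; apply: lat_inv_funK. Qed.

HB.instance Definition _ :=
  isGroup.Build (lat_aut E) lat_mulA lat_mul1 lat_mulr1 lat_mulV lat_mulrV.

Lemma lat_aut1E (x : E) : (1 : lat_aut E) x = x. Proof. by []. Qed.
Lemma lat_autME S T (x : E) : (S * T) x = S (T x). Proof. by []. Qed.
End LatAutGroup.

(* The group is the whole finGroupType; a multiplicative map between groups
   preserves 1 and inverses. *)
Notation pos_rep gT E := {multiplicative gT -> lat_aut E}.

Definition order_equiv (R : realType) (gT : finGroupType) (E F : rieszType R)
    (rho : pos_rep gT E) (theta : pos_rep gT F) : Prop :=
  exists2 T : E -> F, lattice_iso T &
    forall (s : gT) (x : E), T (rho s x) = theta s (T x).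

Section OrderDirectSum.
Variables (R : realType) (I : finType) (E : I -> rieszType R).

Definition dsum : Type := {dffun forall i : I, E i}.

HB.instance Definition _ := Choice.on dsum.
Implicit Types (u v w : dsum) (a b : R).

Let add u v : dsum := [ffun i => u i + v i].
Let opp u : dsum := [ffun i => - u i].
Let zero : dsum := [ffun i => 0].
Let scale a u : dsum := [ffun i => a *: u i].
Let le u v : bool := [forall i, u i <= v i].
Let meet u v : dsum := [ffun i => rmeet (u i) (v i)].
Let join u v : dsum := [ffun i => rjoin (u i) (v i)].

Let addA : associative add.
Proof. by move=> u v w; apply/ffunP=> i; rewrite !ffunE addrA. Qed.
Let addC : commutative add.
Proof. by move=> u v; apply/ffunP=> i; rewrite !ffunE addrC. Qed.
Let add0 : left_id zero add.
Proof. by move=> u; apply/ffunP=> i; rewrite !ffunE add0r. Qed.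
Let addN : left_inverse zero opp add.
Proof. by move=> u; apply/ffunP=> i; rewrite !ffunE addNr. Qed.

HB.instance Definition _ := GRing.isZmodule.Build dsum addA addC add0 addN.

Let scaleA a b u : scale a (scale b u) = scale (a * b) u.
Proof. by apply/ffunP=> i; rewrite !ffunE scalerA. Qed.
Let scale1 : left_id 1 scale.
Proof. by move=> u; apply/ffunP=> i; rewrite !ffunE scale1r. Qed.
Let scaleDr : right_distributive scale +%R.
Proof. by move=> a u v; apply/ffunP=> i; rewrite !ffunE scalerDr. Qed.
Let scaleDl u : {morph scale^~ u : a b / a + b}.
Proof. by move=> a b; apply/ffunP=> i; rewrite !ffunE scalerDl. Qed.

HB.instance Definition _ :=
  GRing.Zmodule_isLmodule.Build R dsum scaleA scale1 scaleDr scaleDl.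

Let le_refl : reflexive le.
Proof. by move=> u; apply/forallP=> i. Qed.
Let le_anti : antisymmetric le.
Proof.
move=> u v /andP[/forallP uv /forallP vu]; apply/ffunP=> i.
by apply/eqP; rewrite eq_le uv vu.
Qed.
Let le_trans : transitive le.
Proof.
move=> v u w /forallP uv /forallP vw; apply/forallP=> i.
exact: Order.POrderTheory.le_trans (uv i) (vw i).
Qed.

HB.instance Definition _ :=
  Order.Le_isPOrder.Build ring_display dsum le_refl le_anti le_trans.

Let le_meet u v w : (u <= meet v w) = (u <= v) && (u <= w).
Proof.
apply/forallP/andP=> [uvw|[/forallP uv /forallP uw] i].
  by split; apply/forallP=> i; move: (uvw i); rewrite ffunE rlexI => /andP[].
by rewrite ffunE rlexI uv uw.
Qed.
Let le_join u v w : (join u v <= w) = (u <= w) && (v <= w).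
Proof.
apply/forallP/andP=> [uvw|[/forallP uw /forallP vw] i].
  by split; apply/forallP=> i; move: (uvw i); rewrite ffunE rleUx => /andP[].
by rewrite ffunE rleUx uw vw.
Qed.

Let leD2r u v w : u <= v -> u + w <= v + w.
Proof.
by move=> /forallP uv; apply/forallP=> i; rewrite !ffunE rleD2r // uv.
Qed.
Let scale_ge0 a u : 0 <= a -> 0 <= u -> 0 <= a *: u.
Proof.
move=> a0 /forallP u0; apply/forallP=> i; move: (u0 i).
by rewrite !ffunE; apply: rscale_ge0.
Qed.

HB.instance Definition _ :=
  Lmodule_POrder_isRiesz.Build R dsum le_meet le_join leD2r scale_ge0.

Lemma dsumDE u v i : (u + v) i = u i + v i. Proof. exact: ffunE. Qed.
Lemma dsumZE a u i : (a *: u) i = a *: u i. Proof. exact: ffunE. Qed.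
Lemma dsum_meetE u v i : rmeet u v i = rmeet (u i) (v i).
Proof. exact: ffunE. Qed.
Lemma dsum_joinE u v i : rjoin u v i = rjoin (u i) (v i).
Proof. exact: ffunE. Qed.
Lemma dsum_leE u v : (u <= v) = [forall i, u i <= v i]. Proof. by []. Qed.
Lemma dsum_ge0 u : (0 <= u) = [forall i, 0 <= u i].
Proof. by apply: eq_forallb => i; rewrite ffunE. Qed.

Section Representation.
Variables (gT : finGroupType) (rho : forall i, pos_rep gT (E i)).

Definition dsum_fun (s : gT) (u : dsum) : dsum := [ffun i => rho i s (u i)].

Lemma dsum_fun_can s t : (s * t = 1)%g -> cancel (dsum_fun t) (dsum_fun s).
Proof.
move=> st1 u; apply/ffunP=> i; rewrite !ffunE -lat_autME -gmulfM st1.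
suff -> : rho i 1%g = 1%g by [].
by apply: (mulgI (rho i 1%g)); rewrite -gmulfM !mulg1.
Qed.

Lemma dsum_fun_iso s : lattice_iso (dsum_fun s).
Proof.
split.
- move=> a u v; apply/ffunP=> i; case: (lat_aut_iso (rho i s)) => lin _ _ _.
  by rewrite !ffunE lin.
- by exists (dsum_fun s^-1%g); apply: dsum_fun_can; rewrite ?mulVg ?mulgV.
- move=> u v; apply/ffunP=> i; case: (lat_aut_iso (rho i s)) => _ _ rI _.
  by rewrite !ffunE rI.
- move=> u v; apply/ffunP=> i; case: (lat_aut_iso (rho i s)) => _ _ _ rU.
  by rewrite !ffunE rU.
Qed.

Definition dsum_rep (s : gT) : lat_aut dsum := LatAut (dsum_fun_iso s).

Lemma dsum_repM : {morph dsum_rep : s t / (s * t)%g}.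
Proof.
move=> s t; apply: lat_autP => u; apply/ffunP=> i.
by rewrite !ffunE gmulfM.
Qed.

HB.instance Definition _ :=
  isMultiplicative.Build gT (lat_aut dsum) dsum_rep dsum_repM.

End Representation.
End OrderDirectSum.

Definition nfold_rep (R : realType) (gT : finGroupType) (E : rieszType R)
    (n : nat) (rho : pos_rep gT E) : pos_rep gT (dsum (fun _ : 'I_n => E)) :=
  dsum_rep (fun _ : 'I_n => rho).

Section FunctionSpace.
Variables (R : realType) (X : finType).

Definition fspace : Type := {ffun X -> R^o}.

HB.instance Definition _ := GRing.Lmodule.on fspace.
Implicit Types f g h : fspace.

Let le f g : bool := [forall x, (f x : R) <= g x].
Let meet f g : fspace := [ffun x => Num.min (f x : R) (g x)].
Let join f g : fspace := [ffun x => Num.max (f x : R) (g x)].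

Let le_refl : reflexive le.
Proof. by move=> f; apply/forallP=> i. Qed.
Let le_anti : antisymmetric le.
Proof.
move=> f g /andP[/forallP fg /forallP gf]; apply/ffunP=> i.
by apply/eqP; rewrite (eq_le (f i : R)) fg gf.
Qed.
Let le_trans : transitive le.
Proof.
move=> g f h /forallP fg /forallP gh; apply/forallP=> i.
exact: Order.POrderTheory.le_trans (fg i) (gh i).
Qed.

HB.instance Definition _ :=
  Order.Le_isPOrder.Build ring_display fspace le_refl le_anti le_trans.

Let le_meet f g h : (f <= meet g h) = (f <= g) && (f <= h).
Proof.
apply/forallP/andP=> [fgh|[/forallP fg /forallP fh] i].
  by split; apply/forallP=> i; move: (fgh i); rewrite ffunE le_min => /andP[].
by rewrite ffunE le_min fg fh.
Qed.
Let le_join f g h : (join f g <= h) = (f <= h) && (g <= h).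
Proof.
apply/forallP/andP=> [fgh|[/forallP fh /forallP gh] i].
  by split; apply/forallP=> i; move: (fgh i); rewrite ffunE ge_max => /andP[].
by rewrite ffunE ge_max fh gh.
Qed.

Let leD2r f g h : f <= g -> f + h <= g + h.
Proof.
by move=> /forallP fg; apply/forallP=> i; rewrite !ffunE (lerD2r (h i : R)) fg.
Qed.
Let scale_ge0 (a : R) f : 0 <= a -> 0 <= f -> 0 <= a *: f.
Proof.
move=> a0 /forallP f0; apply/forallP=> i; move: (f0 i).
by rewrite !ffunE; apply: mulr_ge0.
Qed.

HB.instance Definition _ :=
  Lmodule_POrder_isRiesz.Build R fspace le_meet le_join leD2r scale_ge0.

Lemma fspace_leE f g : (f <= g) = [forall x, (f x : R) <= g x].
Proof. by []. Qed.
Lemma fspace_meetE f g x : rmeet f g x = Num.min (f x : R) (g x).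
Proof. exact: ffunE. Qed.
Lemma fspace_joinE f g x : rjoin f g x = Num.max (f x : R) (g x).
Proof. exact: ffunE. Qed.

Definition fbasis (x : X) : fspace := [ffun y => (x == y)%:R].

End FunctionSpace.

Section CosetRepresentation.
Local Open Scope group_scope.
Variables (R : realType) (gT : finGroupType) (H : {group gT}).

Definition lcoset_of : Type := {A : {set gT} | A \in lcosets H [set: gT]}.
HB.instance Definition _ := Finite.on lcoset_of.

Lemma lcoset_of_subproof (t : gT) : t *: H \in lcosets H [set: gT].
Proof. by apply/lcosetsP; exists t; rewrite ?inE. Qed.

Definition mk_lcoset (t : gT) : lcoset_of :=
  exist (fun A : {set gT} => A \in lcosets H [set: gT]) _ (lcoset_of_subproof t).

Lemma lcoset_act_subproof (s : gT) (A : lcoset_of) :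
  s *: sval A \in lcosets H [set: gT].
Proof.
case: A => A /= /lcosetsP[t _ ->]; apply/lcosetsP; exists (s * t).
  by rewrite inE.
by rewrite lcosetM.
Qed.

Definition lcoset_act (s : gT) (A : lcoset_of) : lcoset_of :=
  exist (fun B : {set gT} => B \in lcosets H [set: gT]) _
    (lcoset_act_subproof s A).

Lemma lcoset_act_mk s t : lcoset_act s (mk_lcoset t) = mk_lcoset (s * t).
Proof. by apply: val_inj; rewrite /= lcosetM. Qed.

Lemma lcoset_act1 A : lcoset_act 1 A = A.
Proof. by apply: val_inj; exact: mul1g. Qed.

Lemma lcoset_actM s t A : lcoset_act (s * t) A = lcoset_act s (lcoset_act t A).
Proof. by apply: val_inj; rewrite /= lcosetM. Qed.

(* The s^-1 makes this the linear map sending e_{tH} to e_{stH}, see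
   coset_rep_basis. *)
Definition coset_fun (s : gT) (f : fspace R lcoset_of) : fspace R lcoset_of :=
  [ffun A => f (lcoset_act s^-1 A)].

Lemma coset_fun_iso s : lattice_iso (coset_fun s).
Proof.
split.
- by move=> a f g; apply/ffunP=> A; rewrite !ffunE.
- exists (coset_fun s^-1) => f; apply/ffunP=> A; rewrite !ffunE -lcoset_actM.
    by rewrite mulgV lcoset_act1.
  by rewrite mulVg lcoset_act1.
- by move=> f g; apply/ffunP=> A; rewrite !ffunE.
- by move=> f g; apply/ffunP=> A; rewrite !ffunE.
Qed.

Definition coset_rep (s : gT) : lat_aut (fspace R lcoset_of) :=
  LatAut (coset_fun_iso s).

Lemma coset_repM : {morph coset_rep : s t / s * t}.
Proof.
move=> s t; apply: lat_autP => f; apply/ffunP=> A.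
by rewrite !ffunE invMg lcoset_actM.
Qed.

HB.instance Definition _ :=
  isMultiplicative.Build gT (lat_aut (fspace R lcoset_of)) coset_rep coset_repM.

Lemma coset_rep_basis (s t : gT) :
  coset_rep s (fbasis R (mk_lcoset t)) = fbasis R (mk_lcoset (s * t)).
Proof.
apply/ffunP=> A; rewrite !ffunE -lcoset_act_mk; congr ((_ : bool)%:R)%R.
apply/eqP/eqP=> [-> | <-]; rewrite -lcoset_actM ?mulgV ?mulVg lcoset_act1 //.
Qed.

End CosetRepresentation.

Arguments coset_rep R {gT} H.

Definition subgroup_conj_representatives (gT : finGroupType) (k : nat)
    (H : 'I_k -> {group gT}) : Prop :=
  forall K : {group gT}, exists! i : 'I_k, exists x : gT, K :=: (H i :^ x)%g.

(* Main.v *)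
Require Import Defs.
From HB Require Import structures.
From mathcomp Require Import all_boot all_order all_algebra all_fingroup.
From mathcomp Require Import boolp classical_sets reals.

Set Implicit Arguments.
Unset Strict Implicit.
Unset Printing Implicit Defensive.

Import Order.TTheory GRing.Theory Num.Theory.
Local Open Scope ring_scope.

(* A maximal family of pairwise disjoint nonzero positive vectors of E is finite,
   because such families are linearly independent; by maximality each member
   bounds no two disjoint nonzero elements, so by the Archimedean property its
   order interval is a segment, and the family is a basis whose positive cone is
   that of E.  Thus E is a space of functions on a finite set X.  A lattice
   isomorphism between function spaces permutes the points up to positive
   factors; for a finite group these factors disappear after rescaling by an
   invariant strictly positive vector, so rho is the permutation representation
   of a G-set X, and order equivalence amounts to isomorphism of G-sets.
   Splitting X into orbits gives existence.  Uniqueness: the number of points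
   with stabilizer exactly H_i is n_i times a positive constant. *)

(** * Disjointness and atoms in Archimedean Riesz spaces *)

Section RieszTheory.
Variables (R : realType) (E : rieszType R).
Implicit Types (x y z a : E) (c t : R).

Lemma riesz_leD2r z x y : (x + z <= y + z) = (x <= y).
Proof.
apply/idP/idP => [/(rleD2r _ _ (- z))|]; last exact: rleD2r.
by rewrite !addrK.
Qed.

Lemma riesz_subr_ge0 x y : (0 <= y - x) = (x <= y).
Proof. by rewrite -(riesz_leD2r x 0) add0r subrK. Qed.

Lemma riesz_lerBlDr x y z : (x - y <= z) = (x <= z + y).
Proof. by rewrite -(riesz_leD2r y (x - y)) subrK. Qed.

Lemma riesz_lerBrDr x y z : (x <= y - z) = (x + z <= y).
Proof. by rewrite -(riesz_leD2r z x) subrK. Qed.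

Lemma riesz_leD x y z w : x <= y -> z <= w -> x + z <= y + w.
Proof.
move=> xy zt; apply: (@le_trans _ _ (y + z)); first exact: rleD2r.
by rewrite ![y + _]addrC; apply: rleD2r.
Qed.

Lemma riesz_addr_ge0 x y : 0 <= x -> 0 <= y -> 0 <= x + y.
Proof. by move=> x0 y0; have := riesz_leD x0 y0; rewrite addr0. Qed.

Lemma riesz_sum_ge0 (I : Type) (r : seq I) (P : pred I) (F : I -> E) :
  (forall i, P i -> 0 <= F i) -> 0 <= \sum_(i <- r | P i) F i.
Proof.
move=> F0; apply: (big_ind (fun x : E => 0 <= x)) => //.
exact: riesz_addr_ge0.
Qed.

Lemma riesz_le_scale2l c x y : 0 <= c -> x <= y -> c *: x <= c *: y.
Proof.
by move=> c0; rewrite -riesz_subr_ge0 -(riesz_subr_ge0 (c *: x)) -scalerBr;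
  exact: rscale_ge0.
Qed.

Lemma riesz_le_scale2r a c t : 0 <= a -> c <= t -> c *: a <= t *: a.
Proof.
by move=> a0 ct; rewrite -riesz_subr_ge0 -scalerBl rscale_ge0 ?subr_ge0.
Qed.

Lemma riesz_le_scale2r_inv a c t :
  0 <= a -> a != 0 -> c *: a <= t *: a -> c <= t.
Proof.
move=> a0 aN0 cta; rewrite leNgt; apply/negP => tc; case/negP: aN0.
have ct0 : 0 < c - t by rewrite subr_gt0.
rewrite eq_le a0 andbT -[a]scale1r -(mulVf (lt0r_neq0 ct0)) -scalerA.
rewrite -(scaler0 _ ((c - t)^-1)); apply: riesz_le_scale2l.
  by rewrite invr_ge0 ltW.
by rewrite scalerBl riesz_lerBlDr add0r.
Qed.

Lemma rmeet_lb x y : (rmeet x y <= x) && (rmeet x y <= y).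
Proof. by rewrite -rlexI. Qed.

Lemma rmeetC x y : rmeet x y = rmeet y x.
Proof.
have [/andP[? ?] /andP[? ?]] := (rmeet_lb x y, rmeet_lb y x).
by apply/eqP; rewrite eq_le !rlexI; apply/andP; split; apply/andP.
Qed.

(** No absolute values are taken: a zero meet already forces both vectors to be positive. *)
Definition disjoint_riesz x y := rmeet x y == 0.

Lemma disjoint_rieszP x y :
  reflect [/\ 0 <= x, 0 <= y & forall z, z <= x -> z <= y -> z <= 0]
          (disjoint_riesz x y).
Proof.
apply: (iffP eqP) => [xy0|[x0 y0 xy]].
  have := lexx (rmeet x y); rewrite {1}xy0 rlexI => /andP[x0 y0].
  by split=> // z zx zy; rewrite -xy0 rlexI zx zy.
apply/eqP; rewrite eq_le rlexI x0 y0 !andbT.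
by have /andP[? ?] := rmeet_lb x y; apply: xy.
Qed.

Lemma disjoint_rieszC x y : disjoint_riesz x y = disjoint_riesz y x.
Proof. by rewrite /disjoint_riesz rmeetC. Qed.

Lemma disjoint_riesz_le x y z :
  disjoint_riesz x y -> 0 <= z -> z <= y -> disjoint_riesz x z.
Proof.
move=> /disjoint_rieszP[x0 _ xy] z0 zy; apply/disjoint_rieszP; split=> // w wx.
by move=> wz; apply: xy => //; apply: le_trans zy.
Qed.

(** If [w] lies below [x] and [y + z], then [w - z] lies below [x] and [y], so [w <= z] and hence
    [w <= 0]. *)
Lemma disjoint_rieszD x y z :
  disjoint_riesz x y -> disjoint_riesz x z -> disjoint_riesz x (y + z).
Proof.
move=> /disjoint_rieszP[x0 y0 xy] /disjoint_rieszP[_ z0 xz].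
apply/disjoint_rieszP; split=> //; first exact: riesz_addr_ge0.
move=> w wx wyz; apply: xz => //.
rewrite -(add0r z) -riesz_lerBlDr; apply: xy; rewrite riesz_lerBlDr //.
by rewrite -(addr0 w) riesz_leD.
Qed.

(** Additivity covers natural multiples of [y], and [c *: y] lies below one of them. *)
Lemma disjoint_rieszZ c x y :
  0 <= c -> disjoint_riesz x y -> disjoint_riesz x (c *: y).
Proof.
move=> c0 xy; have [x0 y0 _] := disjoint_rieszP _ _ xy.
have x0d : disjoint_riesz x 0 by apply: (disjoint_riesz_le xy).
apply: (@disjoint_riesz_le x (y *+ (Num.bound c))); last first.
- rewrite -scaler_nat; apply: riesz_le_scale2r => //.
  by rewrite -(ger0_norm c0); exact/ltW/(le_lt_trans _ (archi_boundP _)).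
- exact: rscale_ge0.
by elim: (Num.bound c) => // n IHn; rewrite mulrSr disjoint_rieszD.
Qed.

Lemma disjoint_riesz_sum (I : Type) (r : seq I) (P : pred I) (F : I -> E) x :
  0 <= x -> (forall i, P i -> disjoint_riesz x (F i)) ->
  disjoint_riesz x (\sum_(i <- r | P i) F i).
Proof.
move=> x0 xF; apply: (big_ind (disjoint_riesz x)) => //.
  by apply/disjoint_rieszP; split=> // z.
by move=> y z; exact: disjoint_rieszD.
Qed.

Lemma disjoint_riesz_subI x y :
  disjoint_riesz (x - rmeet x y) (y - rmeet x y).
Proof.
have /andP[xl yl] := rmeet_lb x y.
apply/disjoint_rieszP; split; rewrite ?riesz_subr_ge0 // => z.
by rewrite !riesz_lerBrDr => zx zy; rewrite -(riesz_leD2r (rmeet x y)) add0r rlexI zx.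
Qed.

(** Serves twice: for the linear independence of disjoint systems, and to identify the positive cone
    of their span with that of the coordinates. *)
Lemma disjoint_comb_ge0 (I : finType) (e : I -> E) (c : I -> R) :
  (forall i, e i != 0) -> (forall i, 0 <= e i) ->
  (forall i j, i != j -> disjoint_riesz (e i) (e j)) ->
  (0 <= \sum_i c i *: e i) = [forall i, 0 <= c i].
Proof.
move=> eN0 e0 edisj; apply/idP/forallP => [ge0 j|c0]; last first.
  by apply: riesz_sum_ge0 => i _; apply: rscale_ge0.
rewrite leNgt; apply/negP => cj.
(* Otherwise [- c j *: e j > 0] lies below a combination disjoint from it. *)
have d : disjoint_riesz (e j) (\sum_(i | i != j) `|c i| *: e i).
  apply: disjoint_riesz_sum => // i ij; apply: disjoint_rieszZ => //.
  by apply: edisj; rewrite eq_sym.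
have {}d : disjoint_riesz (\sum_(i | i != j) `|c i| *: e i) ((- c j) *: e j).
  by apply: disjoint_rieszZ; rewrite ?oppr_ge0 ?ltW // disjoint_rieszC.
have [_ _ /(_ ((- c j) *: e j)) h] := disjoint_rieszP _ _ d.
suff /h /(_ (lexx _)) : - c j *: e j <= \sum_(i | i != j) `|c i| *: e i.
  rewrite -[X in _ <= X](scale0r (e j)) => /riesz_le_scale2r_inv.
  by rewrite oppr_le0 leNgt cj => /(_ (e0 j) (eN0 j)).
move: ge0; rewrite (bigD1 j) //= scaleNr addrC -{1}[c j *: _]opprK riesz_subr_ge0.
move=> /le_trans; apply; rewrite -riesz_subr_ge0 -sumrB.
apply: riesz_sum_ge0 => i _; rewrite riesz_subr_ge0.
by apply: riesz_le_scale2r => //; exact: ler_norm.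
Qed.

(** * Consequences of the Archimedean property *)

Section Archimedean.
Hypothesis EA : archimedean_riesz E.

(** The positive part of [y] also lies below every [t *: a] with [0 < t]; the values
    [t = 1 / (n + 1)] force it to vanish. *)
Lemma archimedean_le0 a y :
  0 <= a -> (forall t, 0 < t -> y <= t *: a) -> y <= 0.
Proof.
move=> a0 ya; have := lexx (rjoin y 0); rewrite rleUx => /andP[yj j0].
suff <- : rjoin y 0 = 0 by [].
apply: (EA j0 a0) => -[|n]; first by rewrite mulr0n.
have n0 : 0 < n.+1%:R :> R by rewrite ltr0n.
rewrite -[a]scale1r -(mulfV (lt0r_neq0 n0)) -scalerA -scaler_nat.
apply: riesz_le_scale2l; first exact: ltW.
by rewrite rleUx ya ?invr_gt0 // rscale_ge0 // invr_ge0 ltW.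
Qed.

(** The supremum of the admissible [t] works: unbounded scalars would put all multiples of [a] below
    [x] and force [a = 0], and [archimedean_le0] shows that the supremum is attained. *)
Lemma largest_scale a x : 0 <= a -> a != 0 -> 0 <= x ->
  exists c, [/\ 0 <= c, c *: a <= x & forall t, t *: a <= x -> t <= c].
Proof.
move=> a0 aN0 x0; pose S := [set t : R | t *: a <= x]%classic.
have S0 : S 0 by rewrite /S /= scale0r.
have Sb : has_ubound S.
  apply: contrapT => Snb; case/negP: aN0; apply/eqP/(EA a0 x0) => n.
  apply: contrapT => nx; apply: Snb; exists n%:R => t tS; rewrite leNgt.
  apply/negP => nt; apply: nx; rewrite -scaler_nat; apply: le_trans tS.
  by apply: riesz_le_scale2r => //; exact: ltW.
have hS : has_sup S by split=> //; exists 0.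
have ubS t : t *: a <= x -> t <= sup S by move=> tS; apply: ub_le_sup.
exists (sup S); split=> //; first exact: ubS.
rewrite -riesz_subr_ge0 -(riesz_leD2r (sup S *: a - x)) add0r.
rewrite addrA subrK subrr; apply: (@archimedean_le0 a) => // t t0.
have [r rS str] := sup_adherent t0 hS.
rewrite riesz_lerBlDr addrC -riesz_lerBlDr -scalerBl; apply: le_trans rS.
by apply: riesz_le_scale2r => //; exact: ltW.
Qed.

(** The property of a would-be atom that maximality of a disjoint system yields directly. *)
Definition riesz_prime a :=
  forall u v, u <= a -> v <= a -> disjoint_riesz u v -> u = 0 \/ v = 0.

(** For [t <= 1], subtracting the meet of [x] and [t *: a] from both leaves disjoint vectors below
    [a], one of which is zero; so [x] is comparable with every [t *: a]. If [c] is largest with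
    [c *: a <= x], this gives [x <= (t + c) *: a] for all [t > 0]. *)
Lemma riesz_prime_atom a x : 0 <= a -> a != 0 -> riesz_prime a ->
  0 <= x -> x <= a -> exists c, x = c *: a.
Proof.
move=> a0 aN0 ap x0 xa.
have [c [c0 cx cmax]] := largest_scale a0 aN0 x0.
have cmp t : 0 <= t -> t *: a <= x \/ x <= t *: a.
  move=> t0; have [t1|/ltW t1] := leP t 1; last first.
    by right; apply: (le_trans xa); rewrite -[X in X <= _]scale1r riesz_le_scale2r.
  have ta0 : 0 <= t *: a by exact: rscale_ge0.
  have ta : t *: a <= a by rewrite -[X in _ <= X]scale1r riesz_le_scale2r.
  have m0 : 0 <= rmeet x (t *: a) by rewrite rlexI x0 ta0.
  have /andP[ml mr] := rmeet_lb x (t *: a).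
  have sub w : w <= a -> w - rmeet x (t *: a) <= a.
    by move=> wa; rewrite riesz_lerBlDr -(addr0 w) riesz_leD.
  by case: (ap _ _ (sub _ xa) (sub _ ta) (disjoint_riesz_subI _ _)) => /eqP;
    rewrite subr_eq0 => /eqP ->; [right|left].
exists c; apply/eqP; rewrite eq_le cx andbT.
rewrite -(add0r (c *: a)) -riesz_lerBlDr; apply: (@archimedean_le0 a) => // t t0.
rewrite riesz_lerBlDr -scalerDl; case: (cmp (t + c)) => //.
  by rewrite addr_ge0 // ltW.
by move=> /cmax; rewrite gerDr leNgt t0.
Qed.

(** With the largest [c], the meet of [a] and the remainder is some [d *: a]; then
    [(d + c) *: a <= x], so [d <= 0]. *)
Lemma atom_remainder a x : 0 <= a -> a != 0 -> riesz_prime a -> 0 <= x ->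
  exists c, [/\ 0 <= c, 0 <= x - c *: a & disjoint_riesz a (x - c *: a)].
Proof.
move=> a0 aN0 ap x0; have [c [c0 cx cmax]] := largest_scale a0 aN0 x0.
have r0 : 0 <= x - c *: a by rewrite riesz_subr_ge0.
exists c; split=> //; set m := rmeet a (x - c *: a).
have /andP[ma mr] := rmeet_lb a (x - c *: a).
have m0 : 0 <= m by rewrite rlexI a0.
have [d md] := riesz_prime_atom a0 aN0 ap m0 ma.
rewrite /disjoint_riesz eq_le m0 andbT -/m md -(scale0r a).
apply: riesz_le_scale2r => //; rewrite -(lerD2r c) add0r; apply: cmax.
by rewrite scalerDl -md -riesz_lerBrDr.
Qed.

End Archimedean.
End RieszTheory.

(** * Finite dimensional Archimedean Riesz spaces as function spaces *)

Lemma pairwise_to_rem (T : eqType) (r : rel T) (x : T) (s : seq T) :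
  symmetric r -> x \in s -> pairwise r s = pairwise r (x :: rem x s).
Proof.
move=> symr; elim: s => // y s IHs; rewrite inE [rem x _]/=.
have [->|_] /= := eqVneq y x; first by [].
move=> xs; rewrite (IHs xs) (perm_all _ (perm_to_rem xs)) /=.
by rewrite (symr y) -!andbA; congr (_ && _); rewrite andbCA.
Qed.

Section LatticeIso.
Variables (R : realType).
Implicit Types E F : rieszType R.

Lemma linear_mapE E F (T : E -> F) :
  linear T -> exists T' : {linear E -> F}, T = T' :> (E -> F).
Proof.
move=> lT; pose L := GRing.isLinear.Build R E F *:%R T lT.
by exists (HB.pack_for {linear E -> F} T L).
Qed.

(** Meets and joins are determined by the order, and by linearity the order is determined by
    positivity. *)
Lemma order_iso_lattice_iso E F (T : E -> F) : linear T -> bijective T ->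
  (forall x, (0 <= T x) = (0 <= x)) -> lattice_iso T.
Proof.
move=> lT bT T0; have [T' eT] := linear_mapE lT; split=> //.
all: have le_T x y : (T x <= T y) = (x <= y).
all: try by rewrite -riesz_subr_ge0 eT -linearB -eT T0 riesz_subr_ge0.
- move=> x y; have [S TK SK] := bT; have /andP[ml mr] := rmeet_lb x y.
  apply/eqP; rewrite eq_le rlexI !le_T ml mr /=.
  rewrite -[rmeet (T x) _]SK le_T rlexI -!le_T SK.
  exact: rmeet_lb.
- move=> x y; have [S TK SK] := bT.
  have := lexx (rjoin x y); rewrite rleUx => /andP[jl jr].
  apply/eqP; rewrite eq_le rleUx !le_T jl jr !andbT.
  rewrite -[rjoin (T x) _]SK le_T rleUx -!le_T SK.
  by have := lexx (rjoin (T x) (T y)); rewrite rleUx.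
Qed.

Lemma lattice_iso_le E F (T : E -> F) :
  lattice_iso T -> {mono T : x y / x <= y}.
Proof.
move=> [_ bT TI _] x y; have le_meet (G : rieszType R) (a b : G) :
  (a <= b) = (rmeet a b == a).
  by rewrite eq_le rlexI lexx; have /andP[-> _] := rmeet_lb a b.
by rewrite !le_meet -TI (inj_eq (bij_inj bT)).
Qed.

Lemma lattice_iso_ge0 E F (T : E -> F) x : lattice_iso T -> (0 <= T x) = (0 <= x).
Proof.
move=> hT; have [lT _ _ _] := hT; have [T' eT] := linear_mapE lT.
by rewrite -(lattice_iso_le hT 0) eT linear0.
Qed.

Lemma lattice_iso_comp E F (G : rieszType R) (S : F -> G) (T : E -> F) :
  lattice_iso S -> lattice_iso T -> lattice_iso (S \o T).
Proof.
move=> [lS bS SI SU] [lT bT TI TU]; split.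
- by move=> a x y; rewrite /= lT lS.
- exact: bij_comp.
- by move=> x y; rewrite /= TI SI.
- by move=> x y; rewrite /= TU SU.
Qed.

Lemma lattice_iso_inv E F (T : E -> F) : lattice_iso T ->
  exists S : F -> E, [/\ lattice_iso S, cancel T S & cancel S T].
Proof.
move=> hT; have [lT [S TK SK] _ _] := hT; exists S; split=> //.
apply: order_iso_lattice_iso; last first.
- by move=> x; rewrite -(lattice_iso_ge0 _ hT) SK.
- by exists T.
- by move=> a x y; apply: (can_inj TK); rewrite lT !SK.
Qed.

Lemma fspace_ge0 (X : finType) (f : fspace R X) :
  (0 <= f) = [forall x, 0 <= (f x : R)].
Proof. by rewrite fspace_leE; apply: eq_forallb => x; rewrite ffunE. Qed.

End LatticeIso.

(** * Bases of pairwise disjoint vectors *)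

Section AtomicBasis.
Variables (R : realType) (E : finDimRieszType R).
Implicit Types (s : seq E) (a x y : E).

Definition disjoint_system s :=
  [&& all (fun x => x != 0) s, all (fun x => 0 <= x) s & pairwise (@disjoint_riesz R E) s].

Lemma disjoint_system_nth s (i j : 'I_(size s)) : disjoint_system s ->
  i != j -> disjoint_riesz s`_i s`_j.
Proof.
move=> /and3P[_ _ /pairwiseP-/(_ 0) sP]; rewrite neq_ltn => /orP[] ij.
  by apply: sP ij; exact: ltn_ord.
by rewrite disjoint_rieszC; apply: sP ij; exact: ltn_ord.
Qed.

Lemma disjoint_system_comb_ge0 s (c : 'I_(size s) -> R) : disjoint_system s ->
  (0 <= \sum_i c i *: s`_i) = [forall i, 0 <= c i].
Proof.
move=> ds; have /and3P[/allP sN0 /allP s0 _] := ds.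
apply: disjoint_comb_ge0 => [i|i|i j]; last exact: disjoint_system_nth.
  exact/sN0/mem_nth.
exact/s0/mem_nth.
Qed.

(** A vanishing combination and its negative are both positive, so each coefficient is at once
    [>= 0] and [<= 0]. *)
Lemma disjoint_system_free s : disjoint_system s -> free s.
Proof.
move=> ds; apply/(freeP (X := in_tuple s)) => c c0 i.
apply/eqP; rewrite eq_le.
have := @disjoint_system_comb_ge0 s c ds.
have := @disjoint_system_comb_ge0 s (fun i => - c i) ds.
under eq_bigr do rewrite scaleNr.
rewrite sumrN c0 oppr0 lexx => /esym/forallP/(_ i); rewrite oppr_ge0 => ->.
by move=> /esym/forallP/(_ i).
Qed.

Lemma maximal_disjoint_system : exists2 s, disjoint_system s &
  forall s', disjoint_system s' -> (size s' <= size s)%N.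
Proof.
pose P n := `[< exists2 s, disjoint_system s & size s = n >].
have exP : exists n, P n by exists 0; apply/asboolP; exists [::].
have ubP n : P n -> (n <= \dim {:E})%N.
  move=> /asboolP[s /disjoint_system_free sf <-].
  by move: sf; rewrite /free => /eqP <-; rewrite dimvS ?subvf.
case: (ex_maxnP exP ubP) => n /asboolP[s ds <-] smax.
by exists s => // s' ds'; apply: smax; apply/asboolP; exists s'.
Qed.

Section Maximal.
Variable s : seq E.
Hypothesis ds : disjoint_system s.
Hypothesis smax : forall s', disjoint_system s' -> (size s' <= size s)%N.

(** Two nonzero disjoint vectors below [a] could replace [a], giving a longer system. *)
Lemma maximal_disjoint_prime a : a \in s -> riesz_prime a.
Proof.
move=> sa u v ua va uv.
have [->|uN0] := eqVneq u 0; first by left.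
have [->|vN0] := eqVneq v 0; first by right.
have /and3P[/allP sN0 /allP s0 sd] := ds.
have [u0 v0 _] := disjoint_rieszP _ _ uv.
have rs x : x \in rem a s -> x \in s by exact: mem_rem.
have /= /andP[/allP ar rr] : pairwise (@disjoint_riesz R E) (a :: rem a s).
  have symd : symmetric (@disjoint_riesz R E) by exact: disjoint_rieszC.
  by rewrite -(pairwise_to_rem symd sa).
have rd w : 0 <= w -> w <= a -> all (disjoint_riesz w) (rem a s).
  move=> w0 wa; apply/allP => x /ar; rewrite ![disjoint_riesz _ x]disjoint_rieszC.
  by move=> /disjoint_riesz_le; apply.
have : (size [:: u, v & rem a s] <= size s)%N.
  apply: smax; apply/and3P; split=> /=.
  - by rewrite uN0 vN0; apply/allP => x /rs /sN0.
  - by rewrite u0 v0; apply/allP => x /rs /s0.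
  - by rewrite uv rr !rd.
by rewrite /= size_rem // prednK ?ltnn // -has_predT; apply/hasP; exists a.
Qed.

Hypothesis EA : archimedean_riesz E.

Lemma span_maximal_disjoint : <<s>>%VS = fullv.
Proof.
apply/eqP; rewrite eqEsubv subvf; apply/subvP => x _.
have /and3P[/allP sN0 /allP s0 sd] := ds.
suff pos y : 0 <= y -> y \in <<s>>%VS.
  have := lexx (rjoin x 0); rewrite rleUx => /andP[xj j0].
  rewrite -[x](subKr (rjoin x 0)) rpredB // pos //.
  by rewrite riesz_subr_ge0.
move=> y0.
(* Subtract a multiple of each atom in turn; disjointness from the atoms already treated survives
   because the remainder only decreases. *)
have rem_l l : {subset l <= s} -> exists r,
    [/\ 0 <= r, r <= y, {in l, forall a, disjoint_riesz a r} & y - r \in <<l>>%VS].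
  elim: l => [|a l IHl] ls; first by exists y; rewrite subrr mem0v.
  have [|r [r0 ry lr yr]] := IHl; first by move=> b lb; apply: ls; rewrite inE lb orbT.
  have sa : a \in s by apply: ls; rewrite inE eqxx.
  have [c [c0 rc ac]] :=
    atom_remainder EA (s0 _ sa) (sN0 _ sa) (maximal_disjoint_prime sa) r0.
  have rcr : r - c *: a <= r.
    rewrite riesz_lerBlDr -{1}[r]addr0 riesz_leD // rscale_ge0 //.
    exact: s0.
  exists (r - c *: a); split=> //; first exact: le_trans ry.
    move=> b; rewrite inE => /predU1P[-> //|lb].
    exact: disjoint_riesz_le (lr _ lb) _ _.
  rewrite opprB addrCA span_cons memv_add // memvZ //.
  exact: memv_line.
have [//|r [r0 ry sr yr]] := rem_l s.
(* A nonzero remainder, being disjoint from all of [s], would extend [s]. *)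
suff r_0 : r = 0 by rewrite -[y]subr0 -r_0.
apply/eqP; apply: contraT => rN0.
suff /smax /= : disjoint_system (r :: s) by rewrite ltnn.
apply/and3P; split=> /=; rewrite ?rN0 ?r0; try exact/allP.
by rewrite sd andbT; apply/allP => b /sr; rewrite disjoint_rieszC.
Qed.

End Maximal.

Lemma archimedean_fspace : archimedean_riesz E ->
  exists m (T : E -> fspace R 'I_m), lattice_iso T.
Proof.
move=> EA; have [s ds smax] := maximal_disjoint_system.
have sf := disjoint_system_free ds.
pose T (x : E) : fspace R 'I_(size s) := [ffun i => coord (in_tuple s) i x].
have xE x : x = \sum_i T x i *: s`_i.
  have xs : x \in <<in_tuple s>>%VS by rewrite span_maximal_disjoint ?memvf.
  by rewrite {1}(coord_span xs); apply: eq_bigr => i _; rewrite ffunE.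
exists (size s), T; apply: order_iso_lattice_iso.
- by move=> a x y; apply/ffunP => i; rewrite !ffunE linearP.
- exists (fun f : fspace R 'I_(size s) => \sum_i f i *: s`_i) => [x|f] //.
  by apply/ffunP => i; rewrite ffunE (coord_sum_free _ _ (X := in_tuple s)).
- by move=> x; rewrite {2}(xE x) disjoint_system_comb_ge0 // fspace_ge0.
Qed.

End AtomicBasis.

(** * Permutation models of positive representations *)

Section PermutationModels.
Variables (R : realType).

Lemma fspaceZE (X : finType) (c : R) (f : fspace R X) x : (c *: f) x = c * f x.
Proof. by rewrite ffunE. Qed.

(** The image [f] of [fbasis R x] is positive and nonzero, so it dominates [g = f y *: fbasis R y]
    for some [y] with [f y > 0]. Pulled back, [g] is positive and below [fbasis R x], hence a
    multiple of it; so [g] is a multiple of [f], with factor 1 by evaluation at [y]. *)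
Lemma lattice_iso_fbasis (X Y : finType) (S : fspace R X -> fspace R Y) :
  lattice_iso S -> forall x, exists y, exists2 c, 0 < c & S (fbasis R x) = c *: fbasis R y.
Proof.
move=> hS x; have [S' [hS' SK S'K]] := lattice_iso_inv hS.
set f := S _; have f0 : 0 <= f.
  by rewrite lattice_iso_ge0 // fspace_ge0; apply/forallP => z; rewrite ffunE ler0n.
have f0y y : 0 <= (f y : R) by move: f0; rewrite fspace_ge0 => /forallP.
have [y fy] : exists y, 0 < (f y : R).
  apply/existsP; apply: contraT; rewrite negb_exists => /forallP fn.
  have fE : f = 0.
    by apply/ffunP => y; rewrite ffunE; apply/eqP; rewrite eq_le f0y andbT leNgt.
  have : S' f x = 1 by rewrite SK ffunE eqxx.
  have [lS' _ _ _] := hS'; have [L ->] := linear_mapE lS'.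
  by rewrite fE linear0 ffunE => /eqP; rewrite eq_sym oner_eq0.
exists y, (f y) => //; set g := f y *: _.
have g0 : 0 <= g.
  by rewrite rscale_ge0 // fspace_ge0; apply/forallP => z; rewrite ffunE ler0n.
have gf : g <= f.
  rewrite fspace_leE; apply/forallP => z; rewrite fspaceZE ffunE.
  by have [<-|_] := eqVneq; rewrite ?mulr1 ?mulr0.
have /forallP S'g0 : [forall z, 0 <= (S' g z : R)].
  by rewrite -fspace_ge0 lattice_iso_ge0.
have : S' g <= S' f by rewrite (lattice_iso_le hS').
rewrite SK fspace_leE => /forallP S'gx.
have S'gE : S' g = (S' g x : R) *: fbasis R x.
  apply/ffunP => z; rewrite fspaceZE ffunE; have [<-|xz] := eqVneq; first by rewrite mulr1.
  rewrite mulr0; apply/eqP; rewrite eq_le (S'g0 z) andbT.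
  by have := S'gx z; rewrite ffunE (negPf xz).
have gE : g = (S' g x : R) *: f.
  have [lS _ _ _] := hS; have [L SL] := linear_mapE lS.
  by rewrite -[LHS]S'K S'gE SL linearZ -SL -S'gE.
have : g y = f y by rewrite fspaceZE ffunE eqxx mulr1.
rewrite {1}gE fspaceZE -{2}[f y]mul1r => /(mulIf (lt0r_neq0 fy)) e1.
by rewrite gE e1 scale1r.
Qed.

Lemma fspace_iso_perm (X Y : finType) (S : fspace R X -> fspace R Y) :
  lattice_iso S -> exists (phi : X -> Y) (d : X -> R),
    [/\ bijective phi, forall x, 0 < d x & forall f x, S f (phi x) = d x * f x].
Proof.
(* Stated for arbitrary spaces so as to apply to the inverse of [S] too: injections both ways make
   [phi] bijective by cardinality. *)
have basis_inj (X' Y' : finType) (S' : fspace R X' -> fspace R Y') :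
    lattice_iso S' -> exists (phi : X' -> Y') (d : X' -> R), [/\ injective phi,
      forall x, 0 < d x & forall x, S' (fbasis R x) = d x *: fbasis R (phi x)].
  move=> hS'; have /choice[phi /choice[d dP]] : forall x, exists y, exists c,
      0 < c /\ S' (fbasis R x) = c *: fbasis R y.
    by move=> x; have [y [c ? ?]] := lattice_iso_fbasis hS' x; exists y, c.
  exists phi, d; split; [|by move=> x; case: (dP x)|by move=> x; case: (dP x)].
  move=> x y phixy; have [[dx0 Sx] [dy0 Sy]] := (dP x, dP y).
  have [lS' /bij_inj S'I _ _] := hS'; have [L SL] := linear_mapE lS'.
  have /S'I/ffunP/(_ x) : S' (d y *: fbasis R x) = S' (d x *: fbasis R y).
    by rewrite SL !linearZ /= -!SL Sx Sy phixy !scalerA mulrC.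
  rewrite !fspaceZE !ffunE eqxx mulr1; have [//|_] := eqVneq y x.
  by rewrite mulr0 => dy; rewrite dy ltxx in dy0.
move=> hS; have [phi [d [phiI d0 Sb]]] := basis_inj _ _ _ hS.
have [S' [/basis_inj[phi' [_ [phi'I _ _]]] _ _]] := lattice_iso_inv hS.
exists phi, d; split=> //; first exact: inj_card_bij (leq_card _ phi'I).
move=> f x; have [lS _ _ _] := hS; have [L SL] := linear_mapE lS.
have {1}-> : f = \sum_z (f z : R) *: fbasis R z.
  apply/ffunP => z; rewrite sum_ffunE (bigD1 z) //= fspaceZE ffunE eqxx mulr1.
  by rewrite big1 ?addr0 // => t tz; rewrite fspaceZE ffunE (negPf tz) mulr0.
rewrite SL linear_sum sum_ffunE (bigD1 x) //= linearZ -SL Sb !fspaceZE ffunE eqxx mulr1.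
rewrite big1 => [|z zx]; first by rewrite addr0 mulrC.
by rewrite SL linearZ -SL Sb !fspaceZE ffunE (inj_eq phiI) (negPf zx) !mulr0.
Qed.

Variables (gT : finGroupType).

Lemma pos_rep1 (E : rieszType R) (rho : pos_rep gT E) v : rho 1%g v = v.
Proof.
suff -> : rho 1%g = 1%g by [].
by apply: (mulgI (rho 1%g)); rewrite -gmulfM !mulg1.
Qed.

Lemma pos_repM (E : rieszType R) (rho : pos_rep gT E) s t v :
  rho (s * t)%g v = rho s (rho t v).
Proof. by rewrite gmulfM lat_autME. Qed.

(** In the model, [rho s] translates functions on [X] along [act s]. That [act] is a left action
    follows, by [permutes1] and [permutesM]. *)
Definition permutes (E : rieszType R) (X : finType) (rho : pos_rep gT E)
    (act : gT -> X -> X) : Prop :=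
  exists2 T : E -> fspace R X, lattice_iso T &
    forall s v x, T (rho s v) (act s x) = T v x.

Lemma fbasis_eq (X : finType) (x y : X) (c : R) :
  fbasis R x y = c -> c != 0 -> x = y.
Proof. by rewrite ffunE => <-; have [//|_] := eqVneq x y; rewrite eqxx. Qed.

Lemma permutes1 (E : rieszType R) (X : finType) (rho : pos_rep gT E)
    (act : gT -> X -> X) x : permutes rho act -> act 1%g x = x.
Proof.
move=> [T hT Tact]; have [T' [_ _ T'K]] := lattice_iso_inv hT.
apply: (@fbasis_eq _ _ _ 1); rewrite ?oner_eq0 //.
by rewrite -[fbasis _ _]T'K -(Tact 1%g) pos_rep1 T'K ffunE eqxx.
Qed.

Lemma permutesM (E : rieszType R) (X : finType) (rho : pos_rep gT E)
    (act : gT -> X -> X) s t x : permutes rho act ->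
  act (s * t)%g x = act s (act t x).
Proof.
move=> [T hT Tact]; have [T' [_ _ T'K]] := lattice_iso_inv hT.
apply: (@fbasis_eq _ _ _ 1); rewrite ?oner_eq0 //.
(* The indicator is written through a vector in the range of [rho (s * t)], so that its values at
   both points reduce to one coordinate at [x]. *)
have [r [_ _ rK]] := lattice_iso_inv (lat_aut_iso (rho (s * t)%g)).
rewrite -[fbasis _ _]T'K -[T' _]rK pos_repM !Tact -(Tact (s * t)%g) rK T'K.
by rewrite ffunE eqxx.
Qed.

Lemma permutes_fspace (E : rieszType R) (rho : pos_rep gT E) (X : finType)
    (T : E -> fspace R X) : lattice_iso T ->
  exists act : gT -> X -> X, permutes rho act.
Proof.
move=> hT; have [T' [hT' TK T'K]] := lattice_iso_inv hT.
have hS s := fspace_iso_perm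
  (lattice_iso_comp (lattice_iso_comp hT (lat_aut_iso (rho s))) hT').
have /choice[act /choice[d dP]] := hS.
have TE s v x : T (rho s v) (act s x) = d s x * T v x.
  by have [_ _ /(_ (T v))] := dP s; rewrite /= TK.
(* Dividing the coordinates by those of the invariant strictly positive vector
   [u] absorbs the scaling factors [d]. *)
pose u := \sum_s rho s (T' [ffun=> 1]).
have u_inv t : rho t u = u.
  have [lr _ _ _] := lat_aut_iso (rho t); have [L rL] := linear_mapE lr.
  rewrite /u rL linear_sum -rL [RHS](reindex_inj (mulgI t)) /=.
  by apply: eq_bigr => s _; rewrite pos_repM.
have [lT _ _ _] := hT; have [L TL] := linear_mapE lT.
(* Translates of the constant 1 stay strictly positive, as [act s] is onto and the factors are
   positive. *)
have term_gt0 s x : 0 < (T (rho s (T' [ffun=> 1])) x : R).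
  have [[psi _ psiK] d0 _] := dP s.
  by rewrite -(psiK x) TE T'K ffunE mulr1.
have u_gt0 x : 0 < (T u x : R).
  rewrite /u TL linear_sum sum_ffunE (bigD1 1%g) //= -TL.
  by rewrite ltr_pwDl ?term_gt0 // sumr_ge0 // => s _; rewrite ltW.
exists act; exists (fun v => [ffun x => (T v x : R) / T u x] : fspace R X).
  apply: order_iso_lattice_iso.
  - move=> a v w; apply/ffunP => x; rewrite !ffunE lT !ffunE mulrDl.
    by congr (_ + _); apply/esym/mulrA.
  - exists (fun f : fspace R _ => T' [ffun x => (f x : R) * T u x]) => [v|f].
      rewrite -[RHS]TK; congr (T' _); apply/ffunP => x.
      by rewrite !ffunE divfK ?lt0r_neq0.
    by apply/ffunP => x; rewrite !ffunE T'K ffunE mulfK ?lt0r_neq0.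
  - move=> v; rewrite -(lattice_iso_ge0 v hT) !fspace_ge0.
    by apply: eq_forallb => x; rewrite ffunE pmulr_lge0 // invr_gt0.
(* Since [rho s] fixes [u], numerator and denominator pick up the same factor [d s x]. *)
move=> s v x; rewrite !ffunE -{1}(u_inv s) !TE.
have [_ /(_ x) d0 _] := dP s.
by rewrite -mulf_div divff ?mul1r // lt0r_neq0.
Qed.

(** Comparing the models gives a bijection [phi] with positive weights. It is equivariant because
    the indicator of [phi (act s x)] does not vanish at [act' s (phi x)]. *)
Lemma permutes_unique (E : rieszType R) (rho : pos_rep gT E) (X Y : finType)
    (act : gT -> X -> X) (act' : gT -> Y -> Y) :
  permutes rho act -> permutes rho act' ->
  exists2 phi : X -> Y, bijective phi & forall s x, phi (act s x) = act' s (phi x).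
Proof.
move=> [T hT Tact] [U hU Uact].
have [T' [hT' TK _]] := lattice_iso_inv hT.
have [U' [_ _ U'K]] := lattice_iso_inv hU.
have [phi [d [bphi d0 dP]]] := fspace_iso_perm (lattice_iso_comp hU hT').
have UE v x : U v (phi x) = d x * T v x by rewrite -dP /= TK.
exists phi => // s x; have [r [_ _ rK]] := lattice_iso_inv (lat_aut_iso (rho s)).
set f := fbasis R (phi (act s x)); have [v fv] : exists v, f = U (rho s v).
  by exists (r (U' f)); rewrite rK U'K.
apply: (@fbasis_eq _ _ _ (d x * T v x)); first by rewrite -/f fv Uact UE.
have : f (phi (act s x)) = 1 by rewrite ffunE eqxx.
rewrite fv UE Tact => dTv; apply: mulf_neq0; first exact: lt0r_neq0.
by apply/eqP => Tv0; move/eqP: dTv; rewrite Tv0 mulr0 eq_sym oner_eq0.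
Qed.

Lemma permutes_transport (E : rieszType R) (rho : pos_rep gT E) (X Y : finType)
    (act : gT -> X -> X) (act' : gT -> Y -> Y) (phi : Y -> X) :
  bijective phi -> (forall s y, phi (act' s y) = act s (phi y)) ->
  permutes rho act -> permutes rho act'.
Proof.
move=> [psi phiK psiK] phi_act [T hT Tact].
exists (fun v => [ffun y => T v (phi y)] : fspace R Y); last first.
  by move=> s v y; rewrite !ffunE phi_act.
have [T' [hT' TK T'K]] := lattice_iso_inv hT; have [lT _ _ _] := hT.
apply: order_iso_lattice_iso.
- by move=> a v w; apply/ffunP => x; rewrite !ffunE lT !ffunE.
- exists (fun f : fspace R _ => T' [ffun x => f (psi x)]) => [v|f].
    by rewrite -[RHS]TK; congr (T' _); apply/ffunP => x; rewrite !ffunE psiK.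
  by apply/ffunP => x; rewrite !ffunE T'K ffunE phiK.
- move=> v; rewrite -(lattice_iso_ge0 v hT) !fspace_ge0.
  apply/forallP/forallP => v0 x; last by rewrite ffunE.
  by rewrite -(psiK x); have := v0 (psi x); rewrite ffunE.
Qed.

Lemma permutes_order_equiv (E F : rieszType R) (rho : pos_rep gT E)
    (theta : pos_rep gT F) (X : finType) (act : gT -> X -> X) :
  permutes rho act -> permutes theta act -> order_equiv rho theta.
Proof.
move=> rhoX [U hU Uact]; have [T hT Tact] := rhoX.
have [U' [hU' UK U'K]] := lattice_iso_inv hU.
exists (U' \o T); first exact: lattice_iso_comp.
move=> s v; apply: (can_inj UK); rewrite /= U'K; apply/ffunP => x.
(* Each point [x] is [act s] of the point [act s^-1 x]. *)
rewrite -[x](permutes1 _ rhoX) -(mulgV s) (permutesM _ _ _ rhoX).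
by rewrite Tact Uact U'K.
Qed.

Lemma order_equiv_permutes (E F : rieszType R) (rho : pos_rep gT E)
    (theta : pos_rep gT F) (X : finType) (act : gT -> X -> X) :
  order_equiv rho theta -> permutes theta act -> permutes rho act.
Proof.
move=> [U hU Urho] [T hT Tact]; exists (T \o U); first exact: lattice_iso_comp.
by move=> s v x; rewrite /= Urho Tact.
Qed.

End PermutationModels.

(** * Decomposition of finite G-sets *)

Section FiniteGSets.
Local Open Scope group_scope.
Variable gT : finGroupType.

Definition is_left_action (X : finType) (act : gT -> X -> X) : Prop :=
  (forall x, act 1 x = x) /\ (forall s t x, act (s * t) x = act s (act t x)).

Definition stab (X : finType) (act : gT -> X -> X) (x : X) : {set gT} :=
  [set s | act s x == x].

Section Stabilizer.
Variables (X : finType) (act : gT -> X -> X).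
Hypothesis actP : is_left_action act.

Lemma left_actK s : cancel (act s) (act s^-1).
Proof. by have [a1 aM] := actP; move=> x; rewrite -aM mulVg a1. Qed.

Lemma left_act_inj s : injective (act s).
Proof. exact: can_inj (left_actK s). Qed.

(** As [A :^ t] means [t^-1 A t], this is the usual conjugation by [s] on the left. *)
Lemma stab_act s x : stab act (act s x) = stab act x :^ s^-1.
Proof.
have [_ aM] := actP; apply/setP => t; rewrite mem_conjg invgK !inE.
by rewrite -(inj_eq (@left_act_inj s) (act (t ^ s) x)) -!aM conjgE !mulgA mulgV mul1g.
Qed.

Lemma group_set_stab x : group_set (stab act x).
Proof.
have [a1 aM] := actP; apply/group_setP; split=> [|s t]; first by rewrite inE a1.
by rewrite !inE aM => /eqP sx /eqP ->; rewrite sx.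
Qed.

Canonical stab_group x := Group (group_set_stab x).

End Stabilizer.

Lemma stab_equivariant (X Y : finType) (act : gT -> X -> X) (act' : gT -> Y -> Y)
    (phi : X -> Y) x : injective phi ->
  (forall s x, phi (act s x) = act' s (phi x)) ->
  stab act' (phi x) = stab act x.
Proof. by move=> phiI phiE; apply/setP => s; rewrite !inE -phiE (inj_eq phiI). Qed.

Section Lcosets.
Variable H : {group gT}.

Lemma lcoset_act_left : is_left_action (@lcoset_act gT H).
Proof. by split=> [A|s t A]; [exact: lcoset_act1 | exact: lcoset_actM]. Qed.

Lemma stab_lcoset1 : stab (@lcoset_act gT H) (mk_lcoset H 1) = H.
Proof.
apply/setP => s; rewrite inE -val_eqE /= !lcoset1.
apply/eqP/idP => [<-|sH]; last exact: lcoset_id.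
exact: lcoset_refl.
Qed.

Lemma lcoset_ofP (A : lcoset_of H) : exists t, A = mk_lcoset H t.
Proof.
by case: A => A AH; have /lcosetsP[t _ At] := AH; exists t; apply: val_inj.
Qed.

Lemma stab_lcoset t : stab (@lcoset_act gT H) (mk_lcoset H t) = H :^ t^-1.
Proof.
rewrite -[t]mulg1 -lcoset_act_mk stab_act ?stab_lcoset1 ?mulg1 //.
exact: lcoset_act_left.
Qed.

Lemma mk_lcoset_eq s t : (mk_lcoset H s == mk_lcoset H t) = (t^-1 * s \in H).
Proof.
rewrite -val_eqE /= -mem_lcoset.
by apply/eqP/idP => [<-|/lcoset_eqP ->] //; exact: lcoset_refl.
Qed.

Lemma mk_lcoset_repr (A : lcoset_of H) : mk_lcoset H (repr (sval A)) = A.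
Proof.
have [t ->] := lcoset_ofP A; apply/eqP; rewrite mk_lcoset_eq -mem_lcoset.
by rewrite (mem_repr t) // lcoset_refl.
Qed.

End Lcosets.

(** * Disjoint unions of coset spaces and their decomposition theory *)

Section CosetSums.
Variables (k : nat) (H : 'I_k -> {group gT}).

Definition coset_sum (n : 'I_k -> nat) : finType :=
  {i : 'I_k & ('I_(n i) * lcoset_of (H i))%type}.

Definition coset_sum_pt n i (j : 'I_(n i)) (A : lcoset_of (H i)) : coset_sum n :=
  Tagged (fun i => ('I_(n i) * lcoset_of (H i))%type) (j, A).

Definition coset_sum_act n (s : gT) (p : coset_sum n) : coset_sum n :=
  coset_sum_pt (tagged p).1 (lcoset_act s (tagged p).2).

Lemma coset_sum_pt_inj n i : injective (fun q => @coset_sum_pt n i q.1 q.2).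
Proof. by move=> [j A] [j' A'] /eqP; rewrite eq_Tagged => /eqP. Qed.

Lemma coset_sum_permutes (R : realType) (n : 'I_k -> nat) :
  permutes (dsum_rep (fun i => nfold_rep (n i) (coset_rep R (H i))))
    (@coset_sum_act n).
Proof.
set E := fun i => dsum (fun _ : 'I_(n i) => fspace R (lcoset_of (H i))).
pose T (u : dsum E) : fspace R (coset_sum n) :=
  [ffun p => u (tag p) (tagged p).1 (tagged p).2].
exists T; last first.
  move=> s u [i [j A]]; rewrite !ffunE /=.
  by rewrite -lcoset_actM mulVg lcoset_act1.
apply: order_iso_lattice_iso.
- by move=> a u v; apply/ffunP => p; rewrite !ffunE.
- exists (fun f : fspace R (coset_sum n) =>
    [ffun i => [ffun j => [ffun A => f (coset_sum_pt j A)]]] : dsum E).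
    move=> u; apply/ffunP => i; apply/ffunP => j; apply/ffunP => A.
    by rewrite !ffunE.
  by move=> f; apply/ffunP => -[i [j A]]; rewrite !ffunE.
- move=> u; rewrite fspace_ge0 dsum_ge0; apply/forallP/forallP => u0.
    move=> i; rewrite dsum_ge0; apply/forallP => j; rewrite fspace_ge0.
    by apply/forallP => A; have := u0 (coset_sum_pt j A); rewrite ffunE.
  move=> [i [j A]]; have := u0 i; rewrite dsum_ge0 => /forallP/(_ j).
  by rewrite fspace_ge0 ffunE => /forallP.
Qed.

Lemma stab_coset_sum n (p : coset_sum n) :
  stab (@coset_sum_act n) p = stab (@lcoset_act gT (H (tag p))) (tagged p).2.
Proof.
case: p => i [j A]; apply/setP => s; rewrite !inE.
rewrite [LHS](inj_eq (@coset_sum_pt_inj n i) (j, lcoset_act s A) (j, A)).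
by rewrite xpair_eqE eqxx.
Qed.

Hypothesis HH : subgroup_conj_representatives H.

Lemma conj_representatives_inj i j x y : H i :^ x = H j :^ y -> i = j.
Proof.
move=> ij; have [l [_ lu]] := HH (H i :^ x)%G.
by rewrite -(lu i) ?(lu j) //; [exists y|exists x].
Qed.

(** Stabilizers in a coset space of [H j] are conjugates of [H j], and distinct representatives are
    not conjugate. *)
Lemma stab_coset_sum_tag n (p : coset_sum n) i :
  stab (@coset_sum_act n) p = H i -> tag p = i.
Proof.
rewrite stab_coset_sum; have [t ->] := lcoset_ofP (tagged p).2.
by rewrite stab_lcoset -[RHS]conjsg1 => /conj_representatives_inj.
Qed.

(* The second factor is positive: it is the order of [N(H i) / H i]. *)
Lemma card_stab_coset_sum n i :
  #|[set p | stab (@coset_sum_act n) p == H i]| =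
  (n i * #|[set A | stab (@lcoset_act gT (H i)) A == H i]|)%N.
Proof.
rewrite -[n i in RHS]card_ord -cardsT -cardsX -(card_imset _ (@coset_sum_pt_inj n i)).
apply: eq_card => p; rewrite inE; apply/eqP/imsetP => [pi|[[j A]]].
  have := stab_coset_sum_tag pi; move: pi; rewrite stab_coset_sum.
  case: p => i' [j A] /= + ii'; move: j A; rewrite {}ii' => j A Ai.
  by exists (j, A); rewrite // !inE Ai /=.
by rewrite !inE /= => /eqP Ai ->; rewrite stab_coset_sum.
Qed.

(** Equivariant bijections preserve stabilizers, so the numbers of points with stabilizer exactly
    [H i] agree. *)
Lemma coset_sum_unique m n (phi : coset_sum m -> coset_sum n) :
  bijective phi ->
  (forall s x, phi (coset_sum_act s x) = coset_sum_act s (phi x)) -> m =1 n.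
Proof.
move=> bphi phiE i; have phiI := bij_inj bphi.
have : #|[set p | stab (@coset_sum_act m) p == H i]| =
       #|[set p | stab (@coset_sum_act n) p == H i]|.
  rewrite -(card_imset _ phiI); apply: eq_card => q; rewrite inE.
  have [psi phiK psiK] := bphi.
  apply/imsetP/idP => [[p + ->]|]; first by rewrite inE (stab_equivariant _ phiI phiE).
  rewrite -{1}[q]psiK (stab_equivariant _ phiI phiE) => qi.
  by exists (psi q); rewrite ?psiK ?inE.
rewrite !card_stab_coset_sum => /eqP; rewrite eqn_pmul2r => [/eqP //|].
(* The common factor can be cancelled: the trivial coset has stabilizer [H i]. *)
by apply/card_gt0P; exists (mk_lcoset (H i) 1); rewrite inE stab_lcoset1.
Qed.

Section Decomposition.
Variables (X : finType) (act : gT -> X -> X).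
Hypothesis actP : is_left_action act.

Let good x := [exists i, stab act x == H i].

(** Selects in the orbit of [y] a point whose stabilizer is some [H i] itself, not just a conjugate;
    by [orbit_good] the default [y] is never taken. *)
Definition orbit_rep (y : X) : X :=
  odflt y [pick x | [exists s, x == act s y] && good x].

Lemma orbit_good y : exists s, good (act s y).
Proof.
have [i [[z yi] _]] := HH (stab_group actP y); exists z.
by apply/existsP; exists i; rewrite stab_act //= yi -conjsgM mulgV conjsg1.
Qed.

Lemma orbit_repP y : (exists s, orbit_rep y = act s y) /\ good (orbit_rep y).
Proof.
rewrite /orbit_rep; case: pickP => [x /andP[/existsP[s /eqP xs] gx]|np].
  by split=> //; exists s.
have [s gs] := orbit_good y; have /= := np (act s y); rewrite gs andbT.
by move=> /negbT/negP[]; apply/existsP; exists s.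
Qed.

Lemma orbit_rep_act s y : orbit_rep (act s y) = orbit_rep y.
Proof.
have [_ aM] := actP; rewrite /orbit_rep.
have eP : [pred x | [exists t, x == act t (act s y)] && good x] =1
          [pred x | [exists t, x == act t y] && good x].
  move=> x /=; congr (_ && _); apply/existsP/existsP => -[t /eqP ->].
    by exists (t * s); rewrite aM.
  by exists (t * s^-1); rewrite -aM mulgKV.
(* The selecting predicate depends only on the orbit; only the defaults differ, and that case is
   impossible. *)
rewrite (eq_pick eP); case: pickP => //= np.
have [t gt] := orbit_good y; have /= := np (act t y); rewrite gt andbT.
by move=> /negbT/negP[]; apply/existsP; exists t.
Qed.

(** One point for each orbit isomorphic to the coset space of [H i]; their number is the
    multiplicity. *)
Definition orbit_reps i : {set X} :=
  [set x | (orbit_rep x == x) && (stab act x == H i)].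

Lemma coset_sum_exists : exists (n : {ffun 'I_k -> nat}) (phi : coset_sum n -> X),
  bijective phi /\ forall s p, phi (coset_sum_act s p) = act s (phi p).
Proof.
have [a1 aM] := actP.
pose n := [ffun i => #|orbit_reps i|].
have nE i : n i = #|orbit_reps i| by rewrite ffunE.
pose base i (j : 'I_(n i)) := enum_val (cast_ord (nE i) j).
have baseP i j : orbit_rep (base i j) = base i j /\ stab act (base i j) = H i.
  by have := enum_valP (cast_ord (nE i) j); rewrite inE => /andP[/eqP ? /eqP ?].
(* A chosen element of the coset moves the base point; by [phi_mk] any element would do, since [H i]
   fixes that point. *)
pose phi (p : coset_sum n) := act (repr (sval (tagged p).2)) (base _ (tagged p).1).
have phi_mk i j t : phi (coset_sum_pt j (mk_lcoset (H i) t)) = act t (base i j).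
  have : t^-1 * repr (sval (mk_lcoset (H i) t)) \in stab act (base i j).
    by rewrite (baseP i j).2 -mk_lcoset_eq mk_lcoset_repr.
  by rewrite inE -(inj_eq (@left_act_inj _ _ actP t)) -!aM mulKVg => /eqP.
have phi_act s p : phi (coset_sum_act s p) = act s (phi p).
  case: p => i [j A]; have [t ->] := lcoset_ofP A.
  by rewrite /coset_sum_act /= lcoset_act_mk !phi_mk aM.
exists n, phi; split=> //.
(* Equal images share an orbit, hence a base point; its stabilizer determines [i], its rank in the
   enumeration determines [j], and the two coset elements differ by an element of the stabilizer. *)
have phiI : injective phi.
  move=> [i [j A]] [i' [j' A']].
  have [[t ->] [t' ->]] := (lcoset_ofP A, lcoset_ofP A').
  rewrite -!/(coset_sum_pt _ _) !phi_mk => tt'.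
  have bb : base i j = base i' j'.
    have := congr1 orbit_rep tt'; rewrite !orbit_rep_act.
    by rewrite (baseP i j).1 (baseP i' j').1.
  have ii' : i = i'.
    apply: (@conj_representatives_inj _ _ 1 1).
    by rewrite -(baseP i j).2 bb (baseP i' j').2.
  case: _ / ii' j' bb t' A' tt' => j' bb t' _ tt'.
  have jj' : j = j' by move/enum_val_inj/cast_ord_inj: bb.
  rewrite -jj' in tt' *; congr coset_sum_pt; apply/eqP.
  by rewrite mk_lcoset_eq -(baseP i j).2 inE aM tt' -aM mulVg a1.
have phi_surj y : exists p, phi p = y.
  have [[s rs] /existsP[i /eqP ri]] := orbit_repP y.
  have yi : orbit_rep y \in orbit_reps i.
    by rewrite inE ri eqxx rs orbit_rep_act rs eqxx.
  pose j := cast_ord (esym (nE i)) (enum_rank_in yi (orbit_rep y)).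
  (* Since [orbit_rep y = act s y], the element [s^-1] leads from the base point back to [y]. *)
  exists (coset_sum_pt j (mk_lcoset (H i) s^-1)).
  by rewrite phi_mk /base cast_ordKV enum_rankK_in // rs -aM mulVg a1.
have /choice[psi psiK] := phi_surj.
by exists psi => // p; apply: phiI; rewrite psiK.
Qed.

End Decomposition.
End CosetSums.
End FiniteGSets.

(** * Existence and uniqueness of the multiplicities *)

Theorem corollary4p11 (R : realType) (gT : finGroupType) (k : nat)
    (H : 'I_k -> {group gT}) (HH : subgroup_conj_representatives H)
    (E : finDimRieszType R) (EA : archimedean_riesz E) (rho : pos_rep gT E) :
  exists! n : {ffun 'I_k -> nat},
    order_equiv rho (dsum_rep (fun i : 'I_k => nfold_rep (n i) (coset_rep R (H i)))).
Proof.
have [m [T hT]] := archimedean_fspace EA.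
have [act rho_act] := permutes_fspace rho hT.
have actP : is_left_action act.
  by split=> [x|s t x]; [exact: permutes1 rho_act | exact: permutesM rho_act].
have [n [phi [bphi phiE]]] := coset_sum_exists HH actP.
exists n; split.
  apply: permutes_order_equiv (coset_sum_permutes H R n).
  exact: permutes_transport bphi phiE rho_act.
(* A second family of multiplicities gives another permutation model of [rho], and any two models
   are isomorphic G-sets. *)
move=> n' rho_n'; apply/ffunP.
have rho_sum := order_equiv_permutes rho_n' (coset_sum_permutes H R n').
have rho_n := permutes_transport bphi phiE rho_act.
have [psi bpsi psiE] := permutes_unique rho_n rho_sum.
exact: (coset_sum_unique HH bpsi psiE).
Qed.
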